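(* Let $q>4$ be even and let $n\ge q^3$ be even. If we know the answer (a non-minority ball) to each of the $\binom{n}{q}$ possible queries of size $q$ among $n$ balls, then we can find a non-minority ball of the whole set, i.e. some ball is a non-minority ball of the whole set in every coloring consistent with the answers.
   Context: There are $n$ balls, each colored red or blue in an unknown way. A ball $b$ is a non-minority ball of a set $A$ of balls if at least $|A|/2$ balls of $A$ have the color of $b$. In this model a query is a set of $q$ balls, and the answer is (the index of) some non-minority ball of the query, chosen adversarially. *)

(* Defs.v *)
From mathcomp Require Import all_boot.

Set Implicit Arguments.
Unset Strict Implicit.
Unset Printing Implicit Defensive.

(* The two booleans stand for the colors red and blue. *)
Definition coloring (n : nat) := {ffun 'I_n -> bool}.

Definition color_class (n : nat) (c : coloring n) (A : {set 'I_n}) (b : 'I_n) :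
  {set 'I_n} := [set x in A | c x == c b].

(* "At least |A|/2" is stated as |A| <= 2 * _, to avoid the rounding of the
   division on nat. *)
Definition nonminority (n : nat) (c : coloring n) (A : {set 'I_n})
  (b : 'I_n) : Prop :=
  b \in A /\ #|A| <= 2 * #|color_class c A b|.

(* Only the values of ans on sets of size q are answers to queries; its values
   on the other sets play no role. *)
Definition consistent (n q : nat) (ans : {set 'I_n} -> 'I_n)
  (c : coloring n) : Prop :=
  forall Q : {set 'I_n}, #|Q| = q -> nonminority c Q (ans Q).

(* Main.v *)
Require Import Defs.
From mathcomp Require Import all_boot zify.

(** Write q = 2h and let F be the family of color classes of size at most
    n/2 - 1 of consistent colorings.  If no ball were always non-minority, F
    would cover all the balls.  It then suffices to find a q-set Q each of whose
    elements lies in some M in F with |Q :&: M| < h: no element of Q can be its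
    answer.
    Take M1, M2 in F with a union as large as possible and put A = M1 \ M2,
    B = M2 \ M1, R = complement of the union, so that |R| >= 2 + |M1 :&: M2|.
    Maximality gives |A \ M|, |B \ M| >= |M :&: R| for all M in F.  If some
    |M :&: R| >= h - 1, or if |R| >= q, a suitable Q is immediate; otherwise A
    and B have nearly n/2 elements, and Q is made of h - 1 elements of A, h - 1
    elements of B and two elements x, y of R, which only have to avoid the sets
    Mx, My in F containing x and y often enough.  If one M contains two elements
    of R, take Mx = My = M.  If not and |R| >= 3, then two of any three sets
    covering elements of R have a large common gap in A or in B.  If |R| = 2,
    then |A| = |B| = n/2 - 1 and the size bound forces Mx :|: My to miss at least
    two elements of A :|: B, which gives just enough room. *)

Set Implicit Arguments.
Unset Strict Implicit.
Unset Printing Implicit Defensive.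

Ltac set_cases :=
  let z := fresh "z" in
  apply/setP=> z; rewrite !inE;
  repeat match goal with |- context [z \in ?A] => case: (z \in A) end.

(* [lia] splits on every boolean atom of the context, so the membership facts
   are cleared first. *)
Ltac card_lia :=
  repeat match goal with
  | H : is_true (_ \in _) |- _ => clear H
  | H : is_true (~~ _) |- _ => clear H
  | H : is_true (_ \subset _) |- _ => clear H
  | H : is_true [disjoint _ & _] |- _ => clear H
  end; lia.

Section RefutingSets.

Variable T : finType.
Implicit Types (M Q R S U V W X Y : {set T}) (F : {set {set T}}) (x y z : T).

(** * Subsets of prescribed size *)

Lemma subset_card_between X Y k :
  X \subset Y -> #|X| <= k <= #|Y| ->
  exists S, [/\ X \subset S, S \subset Y & #|S| = k].
Proof.
move=> sXY /andP[leXk lekY].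
have [j ek] : exists j, k = #|X| + j by exists (k - #|X|); lia.
move: lekY {leXk}; rewrite {k}ek => lekY.
elim: j lekY => [|j IH] lej; first by exists X; rewrite addn0.
have [|S [sXS sSY cS]] := IH; first by lia.
have [y yY yS] : exists2 y, y \in Y & y \notin S.
  by apply/subsetPn; apply: contraL lej => /subset_leq_card; lia.
exists (y |: S); split; first exact: subset_trans sXS (subsetUr _ _).
  by rewrite subUset sub1set yY.
by rewrite cardsU1 yS cS; lia.
Qed.

Lemma cardsI_avoid S M X k :
  X \subset S -> [disjoint X & M] -> #|S| = #|X| + k -> #|S :&: M| <= k.
Proof.
move=> sXS dXM cS.
have : #|S :&: M| <= #|S :\: X|.
  apply: subset_leq_card; apply/subsetP => z /setIP[zS zM].
  by rewrite inE zS andbT; apply: contraL zM => /(disjointFr dXM) ->.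
by rewrite cardsD (setIidPr sXS) cS; lia.
Qed.

Lemma pick_avoiding U M k j :
  k <= #|U| -> j <= k -> j <= #|U :\: M| ->
  exists S, [/\ S \subset U, #|S| = k & #|S :&: M| <= k - j].
Proof.
move=> lekU lejk lejD.
have [|X [_ sX cX]] := @subset_card_between set0 (U :\: M) j (sub0set _).
  by rewrite cards0.
have [||S [sXS sSU cS]] := @subset_card_between X U k.
- exact: subset_trans sX (subsetDl _ _).
- by rewrite cX lejk.
exists S; split=> //; apply: (cardsI_avoid sXS); last by rewrite cX; lia.
by move: sX; rewrite subsetD => /andP[].
Qed.

(** * Refuting sets and pairs with maximal union *)

Definition refuting F h Q :=
  (#|Q| == h.*2) &&
  [forall b in Q, exists M in F, (b \in M) && (#|Q :&: M| < h)].

Definition max_pair F M1 M2 :=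
  [/\ M1 \in F, M2 \in F &
    forall M M', M \in F -> M' \in F -> #|M :|: M'| <= #|M1 :|: M2|].

Lemma max_pairC F M1 M2 : max_pair F M1 M2 -> max_pair F M2 M1.
Proof.
by case=> F1 F2 mx; split=> // M M' FM FM'; rewrite (setUC M2) mx.
Qed.

Lemma exists_max_pair F : F != set0 -> exists M1 M2, max_pair F M1 M2.
Proof.
case/set0Pn=> M0 F0.
have P0 : ((M0, M0).1 \in F) && ((M0, M0).2 \in F) by rewrite F0.
pose P (p : {set T} * {set T}) := (p.1 \in F) && (p.2 \in F).
case: (@arg_maxnP _ (M0, M0) P (fun p => #|p.1 :|: p.2|) P0).
case=> M1 M2 /= /andP[F1 F2] mx.
by exists M1, M2; split=> // M M' FM FM'; apply: (mx (M, M')); rewrite /P /= FM.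
Qed.

(** Replacing [M1] by [M] in the pair adds the left-hand set to the union and removes the right-hand
    one, and maximality forbids a net gain. *)
Lemma card_max_pair F M1 M2 M : max_pair F M1 M2 -> M \in F ->
  #|M :&: ~: (M1 :|: M2)| <= #|(M1 :\: M2) :\: M|.
Proof.
move=> [F1 F2 mx] FM; have := mx _ _ FM F2.
have -> : M :|: M2 = (M :&: ~: (M1 :|: M2)) :|: (M2 :|: (M1 :\: M2) :&: M).
  by set_cases.
have -> : M1 :|: M2 = (M2 :|: (M1 :\: M2)).
  by set_cases.
rewrite !cardsU.
set i1 := #|_ :&: (M2 :|: _ :&: M)|.
set i2 := #|M2 :&: (_ :&: M)|; set i3 := #|M2 :&: (_ :\: _)|.
have -> : i1 = 0.
  by apply/eqP; rewrite cards_eq0; apply/eqP; set_cases.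
have -> : i2 = 0.
  by apply/eqP; rewrite cards_eq0; apply/eqP; set_cases.
have -> : i3 = 0.
  by apply/eqP; rewrite cards_eq0; apply/eqP; set_cases.
rewrite !subn0; have := cardsID M (M1 :\: M2).
have -> : ~: (M2 :|: (M1 :\: M2)) = ~: (M1 :|: M2).
  by set_cases.
by lia.
Qed.

(** * Refuting sets built from a pair and two outside elements *)

(** [M1] meets [S :|: V :|: W] only in [S], and [M2] only in [V]. Having [h.-1] elements each, these
    parts are refuted by [M1] and [M2], so only the elements of [W] need further sets. *)
Lemma refuting_union F h M1 M2 S V W :
    0 < h -> M1 \in F -> M2 \in F ->
    S \subset M1 :\: M2 -> #|S| = h.-1 -> V \subset M2 :\: M1 -> #|V| = h.-1 ->
    W \subset ~: (M1 :|: M2) -> #|W| = 2 ->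
    (forall w, w \in W -> exists M, [/\ M \in F, w \in M &
       #|S :&: M| + #|V :&: M| + #|W :&: M| < h]) ->
  exists Q, refuting F h Q.
Proof.
move=> h0 F1 F2 /subsetP sS cS /subsetP sV cV /subsetP sW cW HW.
pose Q := S :|: V :|: W; exists Q.
have le M : #|Q :&: M| <= #|S :&: M| + #|V :&: M| + #|W :&: M|.
  rewrite /Q !setIUl.
  by apply: leq_trans (leq_card_setU _ _) _; rewrite leq_add2r leq_card_setU.
have dSV : S :&: V = set0.
  apply/setP=> z; rewrite !inE; apply/negP=> /andP[/sS + /sV].
  by rewrite !inE; case: (z \in M1); case: (z \in M2).
have dQW : (S :|: V) :&: W = set0.
  apply/setP=> z; rewrite !inE; apply/negP=> /andP[/orP + /sW].
  by rewrite !inE => -[/sS|/sV]; rewrite !inE; case: (z \in M1); case: (z \in M2).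
apply/andP; split.
  by rewrite /Q !cardsU dQW dSV cards0 cS cV cW; apply/eqP; card_lia.
apply/forall_inP=> b; rewrite !inE -orbA => /or3P[bS|bV|/HW[M [FM bM lt]]].
- apply/exists_inP; exists M1 => //; have := sS _ bS; rewrite inE => /andP[_ ->] /=.
  have sub : Q :&: M1 \subset S.
    apply/subsetP=> z; rewrite !inE => /andP[/orP[/orP[|/sV]|/sW]] //;
      by rewrite !inE; case: (z \in M1); case: (z \in M2).
  by have := subset_leq_card sub; rewrite cS; card_lia.
- apply/exists_inP; exists M2 => //; have := sV _ bV; rewrite inE => /andP[_ ->] /=.
  have sub : Q :&: M2 \subset V.
    apply/subsetP=> z; rewrite !inE => /andP[/orP[/orP[/sS|]|/sW]] //;
      by rewrite !inE; case: (z \in M1); case: (z \in M2).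
  by have := subset_leq_card sub; rewrite cV; card_lia.
by apply/exists_inP; exists M => //; rewrite bM /=; apply: leq_ltn_trans (le M) lt.
Qed.

Lemma refuting_pair F h M1 M2 S V Mx My x y :
    0 < h -> M1 \in F -> M2 \in F -> Mx \in F -> My \in F ->
    S \subset M1 :\: M2 -> #|S| = h.-1 -> V \subset M2 :\: M1 -> #|V| = h.-1 ->
    x \notin M1 :|: M2 -> y \notin M1 :|: M2 ->
    x \in Mx -> y \notin Mx -> y \in My -> x \notin My ->
    #|S :&: Mx| + #|V :&: Mx| + 1 < h -> #|S :&: My| + #|V :&: My| + 1 < h ->
  exists Q, refuting F h Q.
Proof.
move=> h0 F1 F2 Fx Fy sS cS sV cV xR yR xMx yMx yMy xMy ltx lty.
have xy : x != y by apply: contraNneq yMx => <-.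
apply: (refuting_union h0 F1 F2 sS cS sV cV (W := [set x; y])).
- by apply/subsetP=> z; rewrite in_setC => /set2P[] ->.
- by rewrite cards2 xy.
move=> w /set2P[] ->; [exists Mx | exists My]; split=> //.
  have -> : [set x; y] :&: Mx = [set x].
    apply/setP=> z; rewrite !inE; case: (z =P x) => [->|_]; first by rewrite xMx.
    by case: (z =P y) => [->|_] //=; apply: negbTE.
  by rewrite cards1.
have -> : [set x; y] :&: My = [set y].
  apply/setP=> z; rewrite !inE; case: (z =P y) => [->|_]; first by rewrite yMy orbT.
  by case: (z =P x) => [->|_] //=; apply: negbTE.
by rewrite cards1.
Qed.

Lemma private_outside F M1 M2 M x : max_pair F M1 M2 -> M \in F ->
  x \in M -> x \notin M1 :|: M2 -> exists a, (a \in M1 :\: M2) && (a \notin M).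
Proof.
move=> mx FM xM xR; have := card_max_pair mx FM.
have : 0 < #|M :&: ~: (M1 :|: M2)|.
  by apply/card_gt0P; exists x; rewrite inE xM in_setC.
move=> /leq_trans H /H /card_gt0P[a].
by rewrite in_setD andbC; exists a.
Qed.

(** Take [S] in the common gap and let [V] contain an element outside [Mx] and one outside [My],
    possibly equal. Each of [Mx], [My] then meets the union in at most 0 + (h - 2) + 1 elements. *)
Lemma refuting_common_gap F h M1 M2 Mx My x y :
    2 < h -> max_pair F M1 M2 -> Mx \in F -> My \in F ->
    x \notin M1 :|: M2 -> y \notin M1 :|: M2 ->
    x \in Mx -> y \notin Mx -> y \in My -> x \notin My ->
    h.-1 <= #|(M1 :\: M2) :\: (Mx :|: My)| -> h.-1 <= #|M2 :\: M1| ->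
  exists Q, refuting F h Q.
Proof.
move=> h2 mx Fx Fy xR yR xMx yMx yMy xMy leA leB; have [F1 F2 _] := mx.
have [|S [_ sS cS]] := subset_card_between (sub0set _) (k := h.-1)
    (Y := (M1 :\: M2) :\: (Mx :|: My)).
  by rewrite cards0.
move: (sS); rewrite subsetD => /andP[sSA dS].
have [bx /andP[bxB bxM]] : exists a, (a \in M2 :\: M1) && (a \notin Mx).
  by apply: (private_outside (max_pairC mx) Fx xMx); rewrite setUC.
have [b_y /andP[byB byM]] : exists a, (a \in M2 :\: M1) && (a \notin My).
  by apply: (private_outside (max_pairC mx) Fy yMy); rewrite setUC.
have [||V [/subsetP sbV sV cV]] := @subset_card_between [set bx; b_y] (M2 :\: M1) h.-1.
- by apply/subsetP=> z /set2P[] ->.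
- by rewrite leB andbT cards2; case: (bx != b_y); card_lia.
have S0 M : M \subset Mx :|: My -> #|S :&: M| = 0.
  move=> sM; apply/eqP; rewrite cards_eq0 setI_eq0.
  exact: disjointWr sM dS.
have V1 b M : b \in [set bx; b_y] -> b \notin M -> #|V :&: M| <= h.-2.
  move=> /sbV bV bM; apply: (@cardsI_avoid V M [set b]).
  - by rewrite sub1set.
  - by rewrite disjoints1.
  - by rewrite cards1 cV; card_lia.
have lx : #|V :&: Mx| <= h.-2 by apply: (V1 bx); rewrite // set21.
have ly : #|V :&: My| <= h.-2 by apply: (V1 b_y); rewrite // set22.
apply: (refuting_pair _ F1 F2 Fx Fy sSA cS sV cV xR yR xMx yMx yMy xMy); first by card_lia.
  by rewrite S0 ?subsetUl //; card_lia.
by rewrite S0 ?subsetUr //; card_lia.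
Qed.

(** A single [M] serves both elements of [W]. [S] avoids [M] and, by maximality, [V] can have two
    elements outside [M], so the count is at most 0 + (h - 3) + 2. *)
Lemma refuting_double F h M1 M2 M :
    2 < h -> max_pair F M1 M2 -> M \in F -> 1 < #|M :&: ~: (M1 :|: M2)| ->
    h.-1 <= #|M1 :\: M2| -> h.-1 <= #|M2 :\: M1| ->
    h.-1 <= #|(M1 :\: M2) :\: M| ->
  exists Q, refuting F h Q.
Proof.
move=> h2 mx FM tr lA lB lAM; have [F1 F2 _] := mx.
have lBM : 1 < #|(M2 :\: M1) :\: M|.
  by apply: leq_trans tr _; rewrite setUC; apply: card_max_pair (max_pairC mx) FM.
have [S [sS cS SM]] := pick_avoiding lA (leqnn _) lAM.
have [|V [sV cV VM]] := @pick_avoiding (M2 :\: M1) M h.-1 2 lB _ lBM; first by card_lia.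
have [|W [_ sW cW]] := subset_card_between (sub0set _) (k := 2)
    (Y := M :&: ~: (M1 :|: M2)).
  by rewrite cards0.
move: sW; rewrite subsetI => /andP[sWM sWR].
apply: (refuting_union _ F1 F2 sS cS sV cV sWR cW); first by card_lia.
move=> w /(subsetP sWM) wM; exists M; split=> //.
by rewrite (setIidPl sWM) cW; card_lia.
Qed.

(** [S] is one uncovered element plus h - 2 elements of [Mx :\: My]; [V] is the mirror image. Each
    of [Mx], [My] meets one of [S], [V] in at most h - 2 elements and misses the other. *)
Lemma refuting_split F h M1 M2 Mx My x y :
    2 < h -> max_pair F M1 M2 -> Mx \in F -> My \in F ->
    x \notin M1 :|: M2 -> y \notin M1 :|: M2 ->
    x \in Mx -> y \notin Mx -> y \in My -> x \notin My ->
    h.-2 <= #|(M1 :\: M2) :&: (Mx :\: My)| ->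
    h.-2 <= #|(M2 :\: M1) :&: (My :\: Mx)| ->
    0 < #|(M1 :\: M2) :\: (Mx :|: My)| -> 0 < #|(M2 :\: M1) :\: (Mx :|: My)| ->
  exists Q, refuting F h Q.
Proof.
move=> h2 mx Fx Fy xR yR xMx yMx yMy xMy lX lY /card_gt0P[a aZ] /card_gt0P[b bZ].
have [F1 F2 _] := mx.
have [|S0 [_ /subsetP sS0 cS0]] := subset_card_between (sub0set _) (k := h.-2)
    (Y := (M1 :\: M2) :&: (Mx :\: My)).
  by rewrite cards0.
have [|V0 [_ /subsetP sV0 cV0]] := subset_card_between (sub0set _) (k := h.-2)
    (Y := (M2 :\: M1) :&: (My :\: Mx)).
  by rewrite cards0.
move: aZ bZ; rewrite !inE !negb_or => /and3P[/andP[ax ay] aM2 aM1] /and3P[/andP[bx b_y] bM1 bM2].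
have aS0 : a \notin S0 by apply/negP=> /sS0; rewrite !inE (negPf ax) !andbF.
have bV0 : b \notin V0 by apply/negP=> /sV0; rewrite !inE (negPf b_y) !andbF.
have SMx : (a |: S0) :&: Mx \subset S0.
  by apply/subsetP=> z; rewrite !inE => /andP[/orP[/eqP->|//]]; rewrite (negPf ax).
have SMy : (a |: S0) :&: My \subset set0.
  apply/subsetP=> z; rewrite !inE => /andP[/orP[/eqP->|/sS0]]; first by rewrite (negPf ay).
  by rewrite !inE; case: (z \in My); rewrite ?andbF.
have VMy : (b |: V0) :&: My \subset V0.
  by apply/subsetP=> z; rewrite !inE => /andP[/orP[/eqP->|//]]; rewrite (negPf b_y).
have VMx : (b |: V0) :&: Mx \subset set0.
  apply/subsetP=> z; rewrite !inE => /andP[/orP[/eqP->|/sV0]]; first by rewrite (negPf bx).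
  by rewrite !inE; case: (z \in Mx); rewrite ?andbF.
move/subset_leq_card: SMx; move/subset_leq_card: SMy.
move/subset_leq_card: VMx; move/subset_leq_card: VMy.
rewrite cards0 cS0 cV0 => v1 v2 v3 v4.
apply: (@refuting_pair F h M1 M2 (a |: S0) (b |: V0) Mx My x y) => //; try card_lia.
- rewrite subUset sub1set !inE aM2 aM1 /=; apply/subsetP=> z /sS0.
  by rewrite !inE => /andP[].
- by rewrite cardsU1 aS0 cS0; card_lia.
- rewrite subUset sub1set !inE bM2 bM1 /=; apply/subsetP=> z /sV0.
  by rewrite !inE => /andP[].
- by rewrite cardsU1 bV0 cV0; card_lia.
Qed.

(** Two uncovered elements in [S] leave h - 3 for [Mx], which makes room for the element [b] of [V]:
    it is chosen outside [My] but may lie in [Mx]. The counts are (h - 3) + 1 + 1 for [Mx] and 0 +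
    (h - 2) + 1 for [My]. *)
Lemma refuting_one_sided F h M1 M2 Mx My x y :
    2 < h -> max_pair F M1 M2 -> Mx \in F -> My \in F ->
    x \notin M1 :|: M2 -> y \notin M1 :|: M2 ->
    x \in Mx -> y \notin Mx -> y \in My -> x \notin My ->
    h.-2 <= #|(M1 :\: M2) :&: (Mx :\: My)| ->
    h.-2 <= #|(M2 :\: M1) :&: (My :\: Mx)| ->
    1 < #|(M1 :\: M2) :\: (Mx :|: My)| ->
  exists Q, refuting F h Q.
Proof.
move=> h2 mx Fx Fy xR yR xMx yMx yMy xMy lX lY lZ.
have [F1 F2 _] := mx.
have [b /andP[]] : exists a, (a \in M2 :\: M1) && (a \notin My).
  by apply: (private_outside (max_pairC mx) Fy yMy); rewrite setUC.
rewrite inE => /andP[bM1 bM2] b_y.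
have [|Z [_ /subsetP sZ cZ]] := subset_card_between (sub0set _) (k := 2)
    (Y := (M1 :\: M2) :\: (Mx :|: My)).
  by rewrite cards0.
have [|S0 [_ /subsetP sS0 cS0]] := subset_card_between (sub0set _) (k := h.-2.-1)
    (Y := (M1 :\: M2) :&: (Mx :\: My)).
  by rewrite cards0; card_lia.
have [|V0 [_ /subsetP sV0 cV0]] := subset_card_between (sub0set _) (k := h.-2)
    (Y := (M2 :\: M1) :&: (My :\: Mx)).
  by rewrite cards0.
have ZS0 : Z :&: S0 = set0.
  apply/setP=> z; rewrite !inE; apply/negP=> /andP[/sZ + /sS0].
  by rewrite !inE; case: (z \in Mx); rewrite ?andbF.
have bV0 : b \notin V0 by apply/negP=> /sV0; rewrite !inE (negPf b_y) !andbF.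
have SMx : (Z :|: S0) :&: Mx \subset S0.
  apply/subsetP=> z; rewrite !inE => /andP[/orP[/sZ|//]].
  by rewrite !inE; case: (z \in Mx).
have SMy : (Z :|: S0) :&: My \subset set0.
  apply/subsetP=> z; rewrite !inE => /andP[/orP[/sZ|/sS0]];
    by rewrite !inE; case: (z \in My); rewrite ?orbT ?andbF.
have VMy : (b |: V0) :&: My \subset V0.
  by apply/subsetP=> z; rewrite !inE => /andP[/orP[/eqP->|//]]; rewrite (negPf b_y).
have VMx : (b |: V0) :&: Mx \subset [set b].
  apply/subsetP=> z; rewrite !inE => /andP[/orP[/eqP->|/sV0]]; first by rewrite eqxx.
  by rewrite !inE; case: (z \in Mx); rewrite ?andbF.
move/subset_leq_card: SMx; move/subset_leq_card: SMy.
move/subset_leq_card: VMx; move/subset_leq_card: VMy.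
rewrite cards0 cards1 cS0 cV0 => v1 v2 v3 v4.
apply: (@refuting_pair F h M1 M2 (Z :|: S0) (b |: V0) Mx My x y) => //; try card_lia.
- by rewrite subUset; apply/andP; split; apply/subsetP=> z;
    [move/sZ | move/sS0]; rewrite !inE => /andP[].
- by rewrite cardsU ZS0 cards0 cZ cS0; card_lia.
- rewrite subUset sub1set !inE bM2 bM1 /=; apply/subsetP=> z /sV0.
  by rewrite !inE => /andP[].
- by rewrite cardsU1 bV0 cV0; card_lia.
Qed.

(** * Counting by Venn regions *)

Lemma card_venn U X Y :
  #|U| = #|U :\: (X :|: Y)| + #|U :&: (X :\: Y)| + #|U :&: (Y :\: X)|
         + #|U :&: (X :&: Y)|.
Proof.
rewrite -!sum1_card !(big_mkcond (fun z => z \in _)) -!big_split /=.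
by apply: eq_bigr => z _; rewrite !inE; do 3![case: (z \in _)].
Qed.

Lemma card_venn_part U X Y :
  #|U :&: X| = #|U :&: (X :\: Y)| + #|U :&: (X :&: Y)|.
Proof.
rewrite -!sum1_card !(big_mkcond (fun z => z \in _)) -!big_split /=.
by apply: eq_bigr => z _; rewrite !inE; do 3![case: (z \in _)].
Qed.

(** An element of [U] in none of the three sets lies in three gaps, one in exactly one set lies in
    one gap, and the others lie in at least two sets: each is counted at least twice. *)
Lemma card_gaps3 U X Y Z :
  #|U|.*2 <= #|U :&: X| + #|U :&: Y| + #|U :&: Z|
    + #|U :\: (X :|: Y)| + #|U :\: (X :|: Z)| + #|U :\: (Y :|: Z)|.
Proof.
rewrite -addnn -!sum1_card !(big_mkcond (fun z => z \in _)) -!big_split /=.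
by apply: leq_sum => z _; rewrite !inE; do 4![case: (z \in _)].
Qed.

Lemma card_symdiffD M1 M2 X :
  #|((M1 :\: M2) :|: (M2 :\: M1)) :\: X|
  = #|(M1 :\: M2) :\: X| + #|(M2 :\: M1) :\: X|.
Proof.
rewrite -!sum1_card !(big_mkcond (fun z => z \in _)) -!big_split /=.
by apply: eq_bigr => z _; rewrite !inE; do 3![case: (z \in _)].
Qed.

Lemma card_symdiffI M1 M2 X :
  #|((M1 :\: M2) :|: (M2 :\: M1)) :&: X|
  = #|(M1 :\: M2) :&: X| + #|(M2 :\: M1) :&: X|.
Proof.
rewrite -!sum1_card !(big_mkcond (fun z => z \in _)) -!big_split /=.
by apply: eq_bigr => z _; rewrite !inE; do 3![case: (z \in _)].
Qed.

Lemma card_symdiff_rest M1 M2 X :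
  #|(M1 :\: M2) :&: X| + #|(M2 :\: M1) :&: X| + #|X :&: ~: (M1 :|: M2)| <= #|X|.
Proof.
rewrite -!sum1_card !(big_mkcond (fun z => z \in _)) -!big_split /=.
by apply: leq_sum => z _; rewrite !inE; do 3![case: (z \in _)].
Qed.

(** * Existence of a refuting set *)

Lemma exists_refuting F h m :
    2 < h -> 30 * h <= m -> #|T| = m.*2 ->
    (forall M, M \in F -> #|M| < m) ->
    (forall x, exists2 M, M \in F & x \in M) ->
  exists Q, refuting F h Q.
Proof.
move=> h2 hm cT ltF cov.
have [M1 [M2 mx]] : exists M1 M2, max_pair F M1 M2.
  apply: exists_max_pair; have /card_gt0P[x _] : 0 < #|T| by lia.
  by have [M FM _] := cov x; apply/set0Pn; exists M.
have [F1 F2 _] := mx; have mx' := max_pairC mx.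
pose A := M1 :\: M2; pose B := M2 :\: M1; pose R := ~: (M1 :|: M2).
have eA : #|M1 :&: M2| + #|A| = #|M1| by apply: cardsID.
have eB : #|M1 :&: M2| + #|B| = #|M2| by rewrite setIC; apply: cardsID.
have eR : #|A| + #|B| + #|M1 :&: M2| + #|R| = m.*2.
  by rewrite -cT -(cardsC (M1 :|: M2)) cardsU -/R; lia.
have lt1 := ltF _ F1; have lt2 := ltF _ F2.
have R2 : 1 < #|R| by lia.
have gapA M : M \in F -> #|M :&: R| <= #|A :\: M| := card_max_pair mx.
have gapB M : M \in F -> #|M :&: R| <= #|B :\: M|.
  by move=> FM; rewrite /R setUC; apply: card_max_pair mx' FM.
have subA M : #|A :&: M| + #|A :\: M| = #|A| := cardsID M A.
have subB M : #|B :&: M| + #|B :\: M| = #|B| := cardsID M B.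
have rest M : #|A :&: M| + #|B :&: M| + #|M :&: R| <= #|M| := card_symdiff_rest M1 M2 M.
case: (boolP [exists M in F, h.-1 <= #|M :&: R|]) => [/exists_inP[M FM tr]|].
  have lA := gapA M FM; have lB := gapB M FM; have sA := subA M; have sB := subB M.
  by apply: (refuting_double h2 mx FM); rewrite -/R -/A -/B; card_lia.
move=> /exists_inPn tr.
have {}tr M : M \in F -> #|M :&: R| < h.-1 by move=> /tr; rewrite -ltnNge.
(* Every member of [F] now meets [R] in fewer than [h.-1] elements, so any 2h elements of [R] will
   do. *)
have [Rbig|Rsmall] := leqP h.*2 #|R|.
  have [|Q [_ sQ cQ]] := @subset_card_between set0 R h.*2 (sub0set _).
    by rewrite cards0.
  exists Q; rewrite /refuting cQ eqxx; apply/forall_inP=> b _.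
  have [M FM bM] := cov b; apply/exists_inP; exists M; rewrite // bM /=.
  apply: leq_trans (leq_trans (tr M FM) (leq_pred h)).
  by rewrite ltnS setIC; apply/subset_leq_card/setIS.
(* Here [#|A|] is 2m - [#|M2|] - [#|R|], which exceeds m - 2h. *)
have hA : 20 * h <= #|A| by card_lia.
have hB : 20 * h <= #|B| by card_lia.
case: (boolP [exists M in F, 1 < #|M :&: R|]) => [/exists_inP[M FM tr2]|].
  have sA := subA M; have sB := subB M; have rM := rest M; have lM := ltF M FM.
  (* [A] and [B] together have more than 2m - 4h elements and [M] fewer than m, so one of the two
     gaps is large. *)
  have [lA|lA] := leqP h.-1 #|A :\: M|.
    by apply: (refuting_double h2 mx FM); rewrite -/R -/A -/B; card_lia.
  by apply: (refuting_double h2 mx' FM); rewrite 1?setUC -/R -/A -/B; card_lia.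
move=> /exists_inPn tr1.
have {}tr1 M : M \in F -> #|M :&: R| <= 1 by move=> /tr1; rewrite -leqNgt.
have sep M x y : M \in F -> x \in R -> y \in R -> x != y -> x \in M -> y \notin M.
  move=> FM xR yR xy xM; apply/negP=> yM; have := tr1 M FM; rewrite leqNgt => /negP; apply.
  by apply/card_gt1P; exists x, y; split; rewrite // in_setI ?xM ?yM.
have gap x y Mx My : x \in R -> y \in R -> x != y -> Mx \in F -> My \in F ->
    x \in Mx -> y \in My ->
    h.-1 <= #|A :\: (Mx :|: My)| \/ h.-1 <= #|B :\: (Mx :|: My)| ->
    exists Q, refuting F h Q.
  move=> xR yR xy Fx Fy xMx yMy leZ.
  have yMx := sep _ _ _ Fx xR yR xy xMx.
  have xMy : x \notin My by rewrite (sep _ y) // eq_sym.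
  move: (xR) (yR); rewrite !in_setC => xR' yR'.
  case: leZ => leZ.
    by apply: (refuting_common_gap h2 mx Fx Fy xR' yR') => //; rewrite -/B; card_lia.
  rewrite setUC in xR' yR'.
  by apply: (refuting_common_gap h2 mx' Fx Fy xR' yR') => //; rewrite -/A; card_lia.
have [R3|R2'] := ltnP 2 #|R|.
  have /card_gt2P[x [y [z [[xR yR zR] [xy yz zx]]]]] := R3.
  have [Mx Fx xMx] := cov x; have [My Fy yMy] := cov y; have [Mz Fz zMz] := cov z.
  (* The six gaps tested below add up to more than (4m - 8h) - 3m, hence to more than 22h, so they
     cannot all be below [h.-1]. *)
  have := card_gaps3 (A :|: B) Mx My Mz.
  have := card_symdiffD M1 M2 set0; rewrite !setD0 -/A -/B => ->.
  rewrite !card_symdiffI !card_symdiffD -/A -/B.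
  have rx := rest Mx; have ry := rest My; have rz := rest Mz.
  have lx := ltF Mx Fx; have ly := ltF My Fy; have lz := ltF Mz Fz => le.
  have [g1|g1] := leqP h.-1 #|A :\: (Mx :|: My)|;
  first by apply: (gap x y Mx My) => //; left.
  have [g2|g2] := leqP h.-1 #|B :\: (Mx :|: My)|;
  first by apply: (gap x y Mx My) => //; right.
  rewrite eq_sym in zx.
  have [g3|g3] := leqP h.-1 #|A :\: (Mx :|: Mz)|;
    first by apply: (gap x z Mx Mz) => //; left.
  have [g4|g4] := leqP h.-1 #|B :\: (Mx :|: Mz)|;
    first by apply: (gap x z Mx Mz) => //; right.
  have [g5|g5] := leqP h.-1 #|A :\: (My :|: Mz)|;
    first by apply: (gap y z My Mz) => //; left.
  have [g6|g6] := leqP h.-1 #|B :\: (My :|: Mz)|;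
    first by apply: (gap y z My Mz) => //; right.
  by card_lia.
have /card_gt1P[x [y [xR yR xy]]] := R2.
have [Mx Fx xMx] := cov x; have [My Fy yMy] := cov y.
have yMx := sep _ _ _ Fx xR yR xy xMx.
have xMy : x \notin My by rewrite (sep _ y) // eq_sym.
have [g1|g1] := leqP h.-1 #|A :\: (Mx :|: My)|;
  first by apply: (gap x y Mx My) => //; left.
have [g2|g2] := leqP h.-1 #|B :\: (Mx :|: My)|;
  first by apply: (gap x y Mx My) => //; right.
have vA := card_venn A Mx My; have vB := card_venn B Mx My.
have vAx := card_venn_part A Mx My; have vBx := card_venn_part B Mx My.
have := card_venn_part A My Mx; have := card_venn_part B My Mx.
rewrite (setIC My Mx) => vBy vAy.
have rx := rest Mx; have ry := rest My; have lx := ltF Mx Fx; have ly := ltF My Fy.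
have tx : 0 < #|Mx :&: R| by apply/card_gt0P; exists x; rewrite in_setI xMx.
have ty : 0 < #|My :&: R| by apply/card_gt0P; exists y; rewrite in_setI yMy.
(* [A] and [B] have 2m - 2 elements in total; [Mx] and [My] each spend an element on [R], so each
   covers at most m - 2 of them. *)
have Z2 : 1 < #|A :\: (Mx :|: My)| + #|B :\: (Mx :|: My)|.
  by clear -lt1 lt2 eA eB eR R2' vA vB vAx vBx vAy vBy rx ry lx ly tx ty; lia.
(* Two uncovered elements lie both in [A], both in [B] (exchange the roles of [M1] and [M2]), or one
   in each. *)
have fin u v Mu Mv : u \in R -> v \in R -> Mu \in F -> Mv \in F ->
    u \in Mu -> v \notin Mu -> v \in Mv -> u \notin Mv ->
    1 < #|A :\: (Mu :|: Mv)| + #|B :\: (Mu :|: Mv)| ->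
    h <= #|A :&: (Mu :\: Mv)| -> h <= #|B :&: (Mv :\: Mu)| ->
    exists Q, refuting F h Q.
  move=> uR vR Fu Fv uMu vMu vMv uMv lZ lX lY.
  have [uR1 vR1] : u \notin M1 :|: M2 /\ v \notin M1 :|: M2 by rewrite -!in_setC.
  have [uR2 vR2] : u \notin M2 :|: M1 /\ v \notin M2 :|: M1 by rewrite setUC.
  have lX' : h.-2 <= #|A :&: (Mu :\: Mv)| by apply: leq_trans lX; clear; lia.
  have lY' : h.-2 <= #|B :&: (Mv :\: Mu)| by apply: leq_trans lY; clear; lia.
  have [lA|lA] := ltnP 1 #|A :\: (Mu :|: Mv)|.
    exact: (refuting_one_sided h2 mx Fu Fv uR1 vR1).
  have [lB|lB] := ltnP 1 #|B :\: (Mu :|: Mv)|.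
    by rewrite setUC in lB; apply: (refuting_one_sided h2 mx' Fv Fu vR2 uR2).
  apply: (refuting_split h2 mx Fu Fv uR1 vR1) => //; rewrite -/A -/B;
    by clear -lA lB lZ; lia.
(* Both gaps are small. If, say, [Mx :\: My] is small on [A], then [My] nearly fills [A], has little
   room left for [B], and [Mx] nearly fills [B]; so the exchanged inequalities hold. *)
have [hX|hX] := boolP ((h <= #|A :&: (Mx :\: My)|) && (h <= #|B :&: (My :\: Mx)|)).
  by have /andP[hXA hYB] := hX; apply: (fin x y Mx My).
apply: (fin y x My Mx) => //; rewrite ?(setUC My Mx) //; move: hX;
  by clear -hm hA hB g1 g2 lt1 lt2 eA eB eR R2' vA vB vAx vBx vAy vBy rx ry
    lx ly tx ty; lia.
Qed.

End RefutingSets.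

(** * From refuting sets to balls and answers *)

Theorem theorem16 (n q : nat) (hq : 4 < q) (q_even : ~~ odd q)
    (hn : q ^ 3 <= n) (n_even : ~~ odd n) (ans : {set 'I_n} -> 'I_n) :
  exists b : 'I_n, forall c : coloring n,
    consistent q ans c -> nonminority c [set: 'I_n] b.
Proof.
pose consb (c : coloring n) :=
  [forall Q : {set 'I_n}, (#|Q| == q) ==>
     (ans Q \in Q) && (#|Q| <= 2 * #|color_class c Q (ans Q)|)].
have consP c : consistent q ans c -> consb c.
  by move=> cc; apply/forallP=> Q; apply/implyP=> /eqP /cc[-> ->].
pose cls (c : coloring n) b := color_class c [set: 'I_n] b.
pose F : {set {set 'I_n}} :=
  [set M | [exists c, exists b, [&& consb c, M == cls c b & 2 * #|M| < n]]].
have [/existsP[b /forallP Hb]|] :=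
    boolP [exists b, [forall c, consb c ==> (n <= 2 * #|cls c b|)]].
  exists b => c /consP cc; split; first by rewrite inE.
  by rewrite cardsT card_ord; have := Hb c; rewrite cc.
move=> /existsPn Hno; exfalso.
have cov b : exists2 M, M \in F & b \in M.
  have /forallPn[c] := Hno b; rewrite negb_imply -ltnNge => /andP[cc lt].
  exists (cls c b); last by rewrite !inE eqxx.
  by rewrite inE; apply/existsP; exists c; apply/existsP; exists b; rewrite cc eqxx.
have [||||Q] := @exists_refuting _ F q./2 n./2 _ _ _ _ cov.
- by lia.
(* Being even, [q] is at least 6, so n/2 is at least 18q = 36h. *)
- have q6 : 5 < q by lia.
  have : q * 36 <= q ^ 3 by rewrite expnS leq_mul2l -[36]/(6 ^ 2) leq_exp2r // q6 orbT.
  by lia.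
- by rewrite card_ord; lia.
- by move=> M; rewrite inE => /existsP[c /existsP[b /and3P[_ _ lt]]]; lia.
move=> /andP[/eqP cQ /forall_inP HQ].
have {}cQ : #|Q| = q by lia.
(* This needs some consistent coloring, which [cov] supplies. *)
have ansQ : ans Q \in Q.
  have [M + _] := cov (ans Q); rewrite inE => /existsP[c /existsP[b /and3P[/forallP cc _ _]]].
  by have := cc Q; rewrite cQ eqxx => /andP[].
have /exists_inP[M + /andP[aM lt]] := HQ _ ansQ.
rewrite inE => /existsP[c /existsP[b /and3P[/forallP cc /eqP eM _]]].
have := cc Q; rewrite cQ eqxx => /andP[_].
(* As [ans Q] lies in [M], a color class of [c], it has the color of that class. *)
suff -> : color_class c Q (ans Q) = Q :&: M by lia.
by move: aM; rewrite eM !inE /= => /eqP eb; apply/setP=> z; rewrite !inE eb.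
Qed.
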